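(* Let $R$ be an integral domain and $M$ a nonzero, non-simple unital $R$-module. Then the divisor topology $D(M)$ is an Alexandrov space.
   Context: For $m,n\in M$ write $m\mid n$ if $n=rm$ for some $r\in R$ (equivalently $Rn\subseteq Rm$). Put $M^{\#}=\{0\neq m\in M: Rm\neq M\}$ and define an equivalence relation on $M^{\#}$ by $m\sim n$ iff $Rm=Rn$; let $[m]$ be the class of $m$ and $\operatorname{EC}(M^{\#})=\{[m]:m\in M^{\#}\}$. For $m\in M^{\#}$ let $U_m=\{[n]\in \operatorname{EC}(M^{\#}): n\mid m\}$. The family $\{U_m\}_{m\in M^{\#}}$ is a basis of a topology on $\operatorname{EC}(M^{\#})$, called the divisor topology of $M$ and denoted $D(M)$ (also denoting the resulting space). A topological space is an Alexandrov space if the intersection of an arbitrary family of open sets is open. *)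

(* Defs.v *)
From HB Require Import structures.
From mathcomp Require Import all_boot all_order all_algebra generic_quotient.
From mathcomp Require Import all_classical.
From mathcomp Require Import topology.

Set Implicit Arguments.
Unset Strict Implicit.
Unset Printing Implicit Defensive.

Import GRing.Theory.
Local Open Scope classical_set_scope.
Local Open Scope ring_scope.
Local Open Scope quotient_scope.

Section Modules.
Context {R : idomainType} {M : lmodType R}.

Definition cyclic_submod (m : M) : set M := [set r *: m | r in [set: R]].

Definition dvdm (m n : M) : Prop := exists r : R, n = r *: m.

Definition sharp : set M := [set m | m != 0 /\ cyclic_submod m <> [set: M]].

Definition simm : rel sharp :=
  fun m n => `[< cyclic_submod (val m) = cyclic_submod (val n) >].

Lemma simm_refl : reflexive simm.
Proof. by move=> m; apply/asboolP. Qed.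

Lemma simm_sym : symmetric simm.
Proof. by move=> m n; apply/asboolP/asboolP. Qed.

Lemma simm_trans : transitive simm.
Proof. by move=> n m p /asboolP mn /asboolP np; apply/asboolP; rewrite mn. Qed.

Canonical simm_equiv := EquivRel simm simm_refl simm_sym simm_trans.

End Modules.

Arguments sharp {R} M.

Section SimpleModule.
Context {R : idomainType}.

Definition nonzero_module (M : lmodType R) : Prop := exists m : M, m != 0.

(* A submodule is given by its Boolean characteristic predicate; as the logic
   is classical, these are all the submodules. *)
Definition simple_module (M : lmodType R) : Prop :=
  nonzero_module M /\
  forall N : {pred M}, submod_closed N -> N =i pred1 0 \/ N =i predT.

End SimpleModule.

Section DivisorTopology.
Context {R : idomainType} (M : lmodType R).

Definition EC : Type := {eq_quot @simm R M}.
HB.instance Definition _ := Choice.on EC.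

Definition EC_class (m : sharp M) : EC := \pi_({eq_quot @simm R M}) m.

Definition divisor_nbhd (m : sharp M) : set EC :=
  [set EC_class n | n in [set n : sharp M | dvdm (val n) (val m)]].

Definition divisor_basis : set (set EC) := range divisor_nbhd.

Lemma EC_classP (m n : sharp M) :
  EC_class m = EC_class n <->
  cyclic_submod (val m) = cyclic_submod (val n).
Proof.
by split=> [/eqmodP/asboolP //|mn]; apply/eqmodP/asboolP.
Qed.

Lemma EC_classW (c : EC) : exists m, c = EC_class m.
Proof. by exists (repr c); rewrite /EC_class reprK. Qed.

Lemma dvdmm (m : M) : dvdm m m.
Proof. by exists 1; rewrite scale1r. Qed.

Lemma dvdm_trans (n m p : M) : dvdm m n -> dvdm n p -> dvdm m p.
Proof. by move=> [r ->] [s ->]; exists (s * r); rewrite scalerA. Qed.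

Lemma dvdmE (m n : M) : dvdm m n <-> cyclic_submod n `<=` cyclic_submod m.
Proof.
split=> [[r ->] _ [s _ <-]|sub]; first by exists (s * r); rewrite // scalerA.
by have [|r _ <-] := sub n; [exists 1; rewrite // scale1r | exists r].
Qed.

Lemma divisor_nbhdE (m n : sharp M) :
  divisor_nbhd m (EC_class n) <-> dvdm (val n) (val m).
Proof.
split=> [[n' n'm /EC_classP nn']|nm]; last by exists n.
by apply/dvdmE; rewrite -nn'; apply/dvdmE.
Qed.

Lemma divisor_basis_cover : \bigcup_(A in divisor_basis) A = [set: EC].
Proof.
rewrite predeqE => c; split=> // _; have [m ->] := EC_classW c.
by exists (divisor_nbhd m); [exists m | apply/divisor_nbhdE/dvdmm].
Qed.

Lemma divisor_basis_join (A B : set EC) (c : EC) :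
  divisor_basis A -> divisor_basis B -> A c -> B c ->
  exists C, [/\ divisor_basis C, C c & C `<=` A `&` B].
Proof.
have [p ->] := EC_classW c.
move=> [m _ <-] [n _ <-] /divisor_nbhdE pm /divisor_nbhdE pn.
exists (divisor_nbhd p); split; [by exists p|exact/divisor_nbhdE/dvdmm|].
by move=> _ [q qp <-]; split; apply/divisor_nbhdE; apply: dvdm_trans qp _.
Qed.

(* The type EC, with the topology whose open sets are the unions of members of
   divisor_basis. *)
Definition divisor_topology : Type := EC.
HB.instance Definition _ := Choice.on divisor_topology.
HB.instance Definition _ := isBaseTopological.Build divisor_topology
  divisor_basis_cover divisor_basis_join.

Lemma divisor_openE (A : set divisor_topology) :
  open A <-> exists2 D : set (set divisor_topology),
    D `<=` divisor_basis & \bigcup_(B in D) B = A.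
Proof. by split=> -[D DB <-]; exists D. Qed.

End DivisorTopology.

Definition alexandrov_space (T : topologicalType) : Prop :=
  forall F : set (set T), (forall A, F A -> open A) ->
    open (\bigcap_(A in F) A).

(* Main.v *)
(* The basic set U_m is the smallest open set containing [m]: if [m] lies in
   U_p then m divides p, so every divisor of m divides p and U_m is contained
   in U_p. A set is therefore open iff it contains U_m along with each of its
   points [m], a condition stable under arbitrary intersections. *)
Require Import Defs.
From mathcomp Require Import all_boot all_algebra.
From mathcomp Require Import all_classical topology.

Local Open Scope classical_set_scope.

(** Ranging over representatives [m] reaches every point of the space, by [EC_classW], and turns
    membership in a basic set into plain divisibility. *)
Lemma divisor_open_nbhdP (R : idomainType) (M : lmodType R)
    (A : set (divisor_topology M)) :
  open A <-> forall m : sharp M, A (EC_class m) -> divisor_nbhd m `<=` A.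
Proof.
split=> [/divisor_openE[D DB <-] m [B DB' Bm]|nbhdA].
  have [p _ BE] := DB _ DB'; subst B.
  move/divisor_nbhdE: Bm => mp _ [q qm <-].
  by exists (divisor_nbhd p) => //; apply/divisor_nbhdE/(dvdm_trans qm mp).
(* [A] is the union of the basic sets of its own points: [nbhdA] keeps the union inside [A], and
   reflexivity of [dvdm] makes it cover [A]. *)
apply/divisor_openE; exists [set divisor_nbhd m | m in [set m | A (EC_class m)]].
  by move=> _ [m _ <-]; exists m.
rewrite eqEsubset; split=> [c [_ [m Am <-]]|c]; first exact: nbhdA.
have [m ->] := EC_classW c => Am.
by exists (divisor_nbhd m); [exists m | apply/divisor_nbhdE/dvdmm].
Qed.

Theorem proposition4 (R : idomainType) (M : lmodType R)
  (M_neq0 : nonzero_module M) (M_nsimple : ~ simple_module M) :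
  alexandrov_space (divisor_topology M).
Proof.
move=> F Fopen; apply/divisor_open_nbhdP => m Fm c mc A FA.
(* [Fm] puts the class of [m] in every member of [F], so the criterion applies to each [A]
   separately. *)
by move/divisor_open_nbhdP: (Fopen A FA); apply; first exact: Fm.
Qed.
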